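(* $\gamma(\mathbb{R},2,a)=+\infty$ for every $a\in[0,2)$.
   Context: Let $X$ be a Banach space, $n\ge 2$ an integer, $a\in[0,n)$ and $k\ge 0$. For a nonempty closed convex subset $C$ of $X$, $\Phi(C,n,a,k)$ denotes the class of all mappings $T:C\to C$ that are $k$-Lipschitzian, i.e. $\|Tx-Ty\|\le k\|x-y\|$ for all $x,y\in C$, and $(n,a)$-rotative, i.e. $\|T^nx-x\|\le a\|Tx-x\|$ for all $x\in C$, where $T^n$ is the $n$-fold composition of $T$ with itself. $\operatorname{Fix}T$ is the set of fixed points of $T$. Define $$\gamma(X,n,a)=\inf\{k\in[0,\infty) : \text{there is a nonempty closed convex subset } C \text{ of } X \text{ and } T\in\Phi(C,n,a,k) \text{ such that } \operatorname{Fix}T=\emptyset\},$$ with the conventions $\inf\emptyset=+\infty$ and $\sup\emptyset=-\infty$. Here $\mathbb{R}$ is the real line with the absolute value as norm. *)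

(* Defs.v *)
From mathcomp Require Import all_boot all_order all_algebra.
From mathcomp Require Import all_classical all_reals all_analysis.

Set Implicit Arguments.
Unset Strict Implicit.
Unset Printing Implicit Defensive.

Import Order.TTheory GRing.Theory Num.Theory.
Import numFieldNormedType.Exports.

Local Open Scope classical_set_scope.
Local Open Scope ring_scope.

(* A self-map of C is encoded as a total map T : X -> X sending C into C;
   every notion below depends only on the values of T on C. *)

Definition rotative (R : realType) (X : normedModType R) (C : set X)
    (n : nat) (a : R) (T : X -> X) : Prop :=
  forall x, C x -> `|iter n T x - x| <= a * `|T x - x|.

Definition Phi (R : realType) (X : normedModType R) (C : set X)
    (n : nat) (a k : R) : set (X -> X) :=
  [set T | [/\ set_fun C C T, k.-lipschitz_C T & rotative C n a T]].

Definition Fix (R : realType) (X : normedModType R) (C : set X)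
    (T : X -> X) : set X :=
  [set x | C x /\ T x = x].

(* X ranges over real Banach spaces. The infimum is taken in the extended
   reals, where ereal_inf set0 = +oo. *)
Definition gamma (R : realType) (X : completeNormedModType R)
    (n : nat) (a : R) : \bar R :=
  ereal_inf [set k%:E | k in [set k : R | 0 <= k /\
    exists C : set X, [/\ C !=set0, closed C, convex_set C &
      exists2 T, Phi C n a k T & Fix C T = set0]]].

(* Main.v *)
(* Without a fixed point, the intermediate value theorem forces T - id to keep
   a constant sign on the interval C; say T x > x. Rotativeness then reads
   T (T x) - T x <= (a - 1) (T x - x), so x + (T x - x) / (2 - a) does not
   increase along an orbit. The orbit is thus increasing and bounded, and its
   supremum is a fixed point. *)
Require Import Defs.
From mathcomp Require Import all_boot all_order all_algebra.
From mathcomp Require Import all_classical all_reals all_analysis.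
From mathcomp Require Import ring lra.

Import Order.TTheory GRing.Theory Num.Theory.
Import numFieldNormedType.Exports.

Local Open Scope ring_scope.

Lemma convex_set_between (R : realType) (C : set R^o) (x y z : R) :
  convex_set C -> C x -> C y -> x <= z <= y -> C z.
Proof.
move=> cC Cx Cy /andP[xz zy].
have [xy|yx] := ltP x y; last first.
  by have -> : z = x by apply/eqP; rewrite eq_le xz (le_trans zy).
have t0 : 0 <= (y - z) / (y - x) by rewrite divr_ge0 // subr_ge0 // ltW.
have t1 : (y - z) / (y - x) <= 1 by rewrite ler_pdivrMr ?subr_gt0 //; lra.
have := cC x y (Itv01 t0 t1) (mem_set Cx) (mem_set Cy).
move=> /set_mem; congr C.
change ((y - z) / (y - x) * x + (1 - (y - z) / (y - x)) * y = z).
by field; rewrite subr_eq0 gt_eqF.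
Qed.

Lemma lipschitz_within_continuous (R : realType) (C : set R^o) (k : R)
    (T : R^o -> R^o) : 0 <= k -> k.-lipschitz_C T ->
  {within C, continuous T}%classic.
Proof.
move=> k0 TL; apply/subspace_continuousP => x Cx.
apply/cvgrPdist_lt => e e0; rewrite near_withinE; near=> y => Cy.
have := TL (x, y) (conj Cx Cy); move=> /= /le_lt_trans; apply.
(* Dividing by [k + 1] rather than [k] keeps the radius meaningful when [k = 0]. *)
have : `|x - y| < e / (k + 1).
  near: y; apply: (@cvgr_dist_lt _ R^o _ _ _ id) => //.
  by rewrite divr_gt0 // ltr_wpDl.
rewrite ltr_pdivlMr; last lra.
have := normr_ge0 (x - y); nra.
Unshelve. all: end_near. Qed.

Lemma not_increasing_rotative (R : realType) (C : set R^o) (a k : R)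
    (T : R^o -> R^o) : a < 2 -> 0 <= k -> C !=set0%classic -> closed C ->
  Phi C 2 a k T -> ~ (forall x, C x -> x < T x).
Proof.
move=> a2 k0 [x0 Cx0] clC [CT TL TR] incr.
pose u n := iter n T x0.
have Cu n : C (u n) by elim: n => [//|n IHn]; exact: CT.
(* This [c] solves [1 + c * (a - 1) = c]: a step of length [d] raises [u n] by [d], while the next
   step has length at most [(a - 1) * d], so the sum bounded in [bnd] cannot grow. *)
pose c := (2 - a)^-1.
have c0 : 0 < c by rewrite invr_gt0 subr_gt0.
have cE : c * (2 - a) = 1 by rewrite mulVf // subr_eq0 gt_eqF.
have bnd n : u n + c * (T (u n) - u n) <= x0 + c * (T x0 - x0).
  elim: n => [//|n]; apply: le_trans.
  have := TR _ (Cu n); rewrite /= -/(u n).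
  have h1 := incr _ (Cu n); have h2 := incr _ (Cu n.+1).
  move: h2; rewrite -[u n.+1]/(T (u n)) => h2.
  by rewrite !gtr0_norm ?subr_gt0 // ?(lt_trans h1) //; nra.
have uB : has_ubound (range u).
  exists (x0 + c * (T x0 - x0)) => _ [n _ <-].
  have := bnd n; have := incr _ (Cu n); nra.
have u0 : (range u !=set0)%classic by exists x0, 0%N.
have Cs : C (sup (range u)).
  apply: clC; apply: (closureS _ (closure_sup u0 uB)) => _ [n _ <-].
  exact: Cu.
set s := sup _ in Cs.
have le_s n : u n <= s by apply: ub_le_sup => //; exists n.
(* An orbit point [u n] this close to [s] gives the contradiction: [T (u n)] is again an orbit
   point, hence at most [s], so [T s - s <= T s - T (u n) <= k * (s - u n) < T s - s]. *)
have e0 : 0 < (T s - s) / (k + 1).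
  by rewrite divr_gt0 ?subr_gt0 ?incr // ltr_wpDl.
have [_ [n _ <-]] := sup_adherent e0 (conj u0 uB); rewrite -/s => sn.
have : s - u n < (T s - s) / (k + 1) by lra.
rewrite ltr_pdivlMr; last lra.
have := TL (s, u n) (conj Cs (Cu n)); rewrite /=.
have hs := incr _ Cs; have := le_s n; have := le_s n.+1.
rewrite -[u n.+1]/(T (u n)) => h1 h2.
rewrite !ger0_norm ?subr_ge0 //; last by rewrite (le_trans h1) // ltW.
nra.
Qed.

(** Conjugation by [x |-> - x] is isometric and commutes with iteration. It reverses the order, so
    the case [T x < x] reduces to the case [x < T x]. *)
Lemma opp_Phi (R : realType) (C : set R^o) (n : nat) (a k : R)
    (T : R^o -> R^o) :
  Phi C n a k T -> Phi (-%R @^-1` C)%classic n a k (fun x => - T (- x)).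
Proof.
move=> [CT TL TR]; split.
- by move=> x Cx /=; rewrite opprK; exact: CT.
- move=> [x y] [/= Cx Cy]; have := TL (- x, - y) (conj Cx Cy).
  by rewrite /= -!opprD !normrN.
- move=> x Cx; have iterN m : iter m (fun x => - T (- x)) x = - iter m T (- x).
    by elim: m => [|m IHm] /=; rewrite ?opprK // IHm opprK.
  by have := TR _ Cx; rewrite iterN /= !opprK -!opprD !normrN.
Qed.

Lemma rotative2_fixpoint (R : realType) (C : set R^o) (a k : R)
    (T : R^o -> R^o) : a < 2 -> 0 <= k -> C !=set0%classic -> closed C ->
  convex_set C -> Phi C 2 a k T -> Fix C T !=set0%classic.
Proof.
move=> a2 k0 C0 clC cC PT; have [CT TL TR] := PT.
apply: contrapT => noFix.
have neqT x : C x -> T x != x.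
  by move=> Cx; apply/eqP => Tx; apply: noFix; exists x.
(* If no point moves up, all points move down and the reflected map is increasing. *)
have [[x [Cx Tx]]|noup] := pselect (exists x, C x /\ x < T x); last first.
  apply: (@not_increasing_rotative R (-%R @^-1` C)%classic a k
    (fun x => - T (- x))) => //.
  - by have [x Cx] := C0; exists (- x); rewrite /= opprK.
  - by apply: preimage_closed => // x _; exact: oppr_continuous.
  - exact: opp_Phi.
  - move=> x Cx; rewrite ltrNr lt_neqAle neqT //= leNgt.
    by apply/negP => ?; apply: noup; exists (- x).
apply: (@not_increasing_rotative R C a k T) => // y Cy.
rewrite ltNge; apply/negP; rewrite le_eqVlt (negbTE (neqT _ Cy)) /= => Ty.
(* Here [x] moves up and [y] moves down, in unknown order; the min/max form of the sign change
   treats both orders alike and is what [IVT] expects at the value 0. *)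
have [m [M [Cm CM mM sgn]]] : exists m M, [/\ C m, C M, m <= M &
    Num.min (T m - m) (T M - M) <= 0 <= Num.max (T m - m) (T M - M)].
  have [xy|yx] := leP x y.
    exists x, y; split=> //.
    by rewrite ge_min le_max !subr_le0 !subr_ge0 (ltW Ty) (ltW Tx) orbT.
  exists y, x; split=> //; first exact: ltW.
  by rewrite ge_min le_max !subr_le0 !subr_ge0 (ltW Ty) (ltW Tx) orbT.
have sub : (`[m, M] `<=` C)%classic.
  by move=> z /=; rewrite in_itv /=; exact: convex_set_between.
have cont : {within `[m, M], continuous (fun x => T x - x)}%classic.
  move=> z; apply: continuousB.
    exact: (continuous_subspaceW sub (lipschitz_within_continuous _ _ _ _ k0 TL)).
  by apply: continuous_subspaceT => w; exact: cvg_id.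
have [z zmM /eqP] := IVT mM cont sgn.
by rewrite subr_eq0; apply/negP/neqT/sub.
Qed.

Theorem corollary6 (R : realType) (a : R) (ha : 0 <= a < 2) :
  gamma R^o 2 a = +oo%E.
Proof.
(* Writing [+oo] as the infimum of the empty set leaves only to show that no [k] is admissible. *)
have /andP[_ a2] := ha; rewrite /gamma -[RHS](@ereal_inf0 R).
congr ereal_inf; apply/seteqP; split=> // y [k [k0 [C [C0 clC cC [T PT FixT]]]] _].
by have [x] := rotative2_fixpoint _ _ _ _ _ a2 k0 C0 clC cC PT; rewrite FixT.
Qed.
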